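(* Let $P$ be a finite nonempty poset. Then $P$ is connected if and only if its $P$-partition generating function $K_P(\mathbf{x})$ is irreducible in $\mathrm{QSym}$.
   Context: $\mathrm{QSym}$ denotes the algebra of quasisymmetric functions in variables $x_1,x_2,\dots$ with coefficients in $\mathbb{C}$. For a finite poset $(P,\preceq)$, a $P$-partition is a map $\theta\colon P\to\mathbb{Z}^+$ with $\theta(x)\le\theta(y)$ whenever $x\preceq y$, and $K_P(\mathbf{x})=\sum_{\theta} x_1^{|\theta^{-1}(1)|}x_2^{|\theta^{-1}(2)|}\cdots$, summed over all $P$-partitions $\theta$ (this is the generating function of $P$ with a natural, i.e. order-preserving, labeling). Irreducible means: not expressible as a product of two non-constant elements of $\mathrm{QSym}$. *)

(* Defs.v *)
From HB Require Import structures.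
From mathcomp Require Import all_boot all_order all_algebra finmap complex.
From mathcomp Require Import boolp classical_sets functions cardinality fsbigop reals.

Set Implicit Arguments.
Unset Strict Implicit.
Unset Printing Implicit Defensive.

Import Order.TTheory GRing.Theory.
Local Open Scope classical_set_scope.
Local Open Scope ring_scope.

(* Variables are indexed from 0: the index i : nat stands for x_(i+1), and     *)
(* accordingly the values of P-partitions are shifted down by one.            *)

(* The exponent vector m stands for x_1^(m 0) x_2^(m 1) ... *)
Definition monom := {fsfun nat -> nat with 0%N}.

Definition mdeg (m : monom) : nat := (\sum_(i <- finsupp m) m i)%N.

(* x_(s_1)^(a_1) ... x_(s_k)^(a_k), for s duplicate-free of the same size as a *)
Definition monom_of (s a : seq nat) : monom :=
  [fsfun i in [fset j in s]%fset => nth 0%N a (index i s) | 0%N].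

Definition fps (F : Type) := monom -> F.

Definition factorizations (m : monom) : set (monom * monom) :=
  [set uv : monom * monom | forall i, m i = (uv.1 i + uv.2 i)%N].

Lemma finite_factorizations (m : monom) : finite_set (factorizations m).
Proof.
pose g (phi : {ffun finsupp m -> 'I_(mdeg m).+1}) : monom :=
  [fsfun i : finsupp m => nat_of_ord (phi i) | 0%N].
have fin_g : finite_set (range g) by apply: finite_image; exact: finite_finset.
have in_g (u : monom) : (forall i, (u i <= m i)%N) -> range g u.
  move=> le_um; exists [ffun i => inord (u (val i))] => //.
  apply/fsfunP => i; rewrite fsfun_ffun; case: insubP => [j _ <-|] /=.
    rewrite ffunE inordK // ltnS (leq_trans (le_um _)) // /mdeg.
    rewrite (big_fsetD1 (val j)) ?fsvalP //=; exact: leq_addr.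
  rewrite memNfinsupp => /eqP mi0; apply/esym/eqP.
  by have := le_um i; rewrite mi0 leqn0.
apply: sub_finite_set (finite_setX fin_g fin_g) => -[u v] /= uv.
by split; apply: in_g => i; rewrite uv ?leq_addr ?leq_addl.
Qed.

(* Each monomial has finitely many factorizations (finite_factorizations), so
   this finitely supported sum is the usual Cauchy product. *)
Definition fps_mul (F : pzRingType) (f g : fps F) : fps F :=
  fun m => \sum_(uv \in factorizations m) f uv.1 * g uv.2.

Definition fps_constant (F : pzRingType) (f : fps F) : Prop :=
  forall m : monom, m != [fsfun] -> f m = 0.

Definition bounded_degree (F : pzRingType) (f : fps F) : Prop :=
  exists d : nat, forall m, f m != 0 -> (mdeg m <= d)%N.

Definition quasisymmetric (F : pzRingType) (f : fps F) : Prop :=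
  forall a s t : seq nat, all (fun k => 0 < k)%N a ->
    sorted ltn s -> sorted ltn t -> size s = size a -> size t = size a ->
    f (monom_of s a) = f (monom_of t a).

Definition QSym (F : pzRingType) : set (fps F) :=
  [set f | bounded_degree f /\ quasisymmetric f].

Definition QSym_irreducible (F : pzRingType) (h : fps F) : Prop :=
  ~ exists f g : fps F, [/\ QSym f, QSym g, ~ fps_constant f, ~ fps_constant g
                          & h = fps_mul f g].

Definition is_P_partition (d : Order.disp_t) (P : finPOrderType d)
    (theta : {ffun P -> nat}) : Prop :=
  forall x y : P, (x <= y)%O -> (theta x <= theta y)%N.

Definition P_partitions_of_content (d : Order.disp_t) (P : finPOrderType d)
    (m : monom) : set {ffun P -> nat} :=
  [set theta | is_P_partition theta
             /\ forall i, #|[pred x | theta x == i]| = m i].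

Lemma finite_P_partitions_of_content (d : Order.disp_t) (P : finPOrderType d)
    (m : monom) : finite_set (@P_partitions_of_content d P m).
Proof.
pose g (phi : {ffun P -> finsupp m}) : {ffun P -> nat} :=
  [ffun x => val (phi x)].
have fin_g : finite_set (range g) by apply: finite_image; exact: finite_finset.
apply: sub_finite_set fin_g => theta [_ cont].
have mem x : theta x \in finsupp m.
  rewrite mem_finsupp -cont -lt0n; apply/card_gt0P; exists x.
  by rewrite inE.
exists [ffun x => [` mem x]%fset] => //.
by apply/ffunP => x; rewrite !ffunE.
Qed.

(* The coefficient of a monomial in K_P is the number of P-partitions with    *)
(* that content, a finite number by finite_P_partitions_of_content.           *)
Definition K_gen (F : pzRingType) (d : Order.disp_t) (P : finPOrderType d) :
    fps F :=
  fun m => #|` fset_set (@P_partitions_of_content d P m)|%fset%:R.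

Definition covers (d : Order.disp_t) (P : finPOrderType d) : rel P :=
  fun x y => (x < y)%O && ~~ [exists z, (x < z)%O && (z < y)%O].

(* Connectedness of the Hasse diagram, as an undirected graph. *)
Definition poset_connected (d : Order.disp_t) (P : finPOrderType d) : Prop :=
  forall x y : P, connect (fun u v => covers u v || covers v u) x y.

(* Main.v *)
(* Write K for K_P.  In the connected case K does not even lie in the square of
   the augmentation ideal of QSym: there is an additive functional that kills
   every product of two elements without constant term but not K.

   A quasisymmetric function is recorded by its coefficients on words of
   exponents.  The Newton recursion a h_a = sum_i h_(a-i) psi_i turns the operators
   h_a, "read off the letter a at the left end", into derivations [newton a]; on
   K_W the latter removes the principal order ideals of size a of W.  Applying the
   same primitive functional at the right end gives [newton_right a].  Their
   difference [coad a] is a derivation preserving the augmentation ideal, so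
   composites newton z o coad a_1 o ... o coad a_m, evaluated at the empty word,
   kill products.  On K_P such a composite is a signed count of the ways to build
   P by adjoining blocks of sizes z, a_1, ..., a_m, each block having a maximum
   and being placed above or below the previous ones; blocks incomparable to the
   previous ones cancel.  Choosing every letter as large as possible forces each
   partial union to be an order ideal of P, so no block can be placed below and
   all signs are +; connectedness makes the count positive.

   The factors of a factorization of K into nonconstant elements have no constant
   term, because K is homogeneous and series of bounded degree form a domain.
   Conversely K is multiplicative over disjoint unions. *)
Require Import Defs.
From HB Require Import structures.
From mathcomp Require Import all_boot all_order all_algebra finmap complex.
From mathcomp Require Import boolp classical_sets functions cardinality.
From mathcomp Require Import fsbigop reals.
(* Imported again so that [set0], [inE], ... are those of finite sets. *)
From mathcomp Require Import fintype finset finmap.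

Set Implicit Arguments.
Unset Strict Implicit.
Unset Printing Implicit Defensive.

Import Order.TTheory GRing.Theory Num.Theory.
Local Open Scope ring_scope.

(** * Functions on words *)

Section WordFunctions.
Variable F : comPzRingType.
Implicit Types (c d : seq nat -> F) (w u v : seq nat) (a : nat).

Definition wcons a c : seq nat -> F := fun w => c (a :: w).

(** The Cauchy product read on exponent words: each letter is split in all ways between the two
    factors. *)
Fixpoint wmul c d w : F :=
  if w is a :: w' then \sum_(i < a.+1) wmul (wcons i c) (wcons (a - i) d) w'
  else c [::] * d [::].

(* The trace of quasisymmetry on functions of words with zero exponents. *)
Definition zinv c := forall u v, c (u ++ 0%N :: v) = c (u ++ v).

Lemma zinv_wcons0 c : zinv c -> wcons 0 c = c.
Proof. by move=> zc; apply/funext => w; exact: (zc [::]). Qed.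

Lemma zinv_pad c u n : zinv c -> c (u ++ nseq n 0%N) = c u.
Proof. by move=> zc; elim: n => [|n IH]; rewrite ?cats0 //= zc. Qed.

Lemma wmulC c d w : wmul c d w = wmul d c w.
Proof.
elim: w c d => [|a w IH] c d /=; first by rewrite mulrC.
rewrite (reindex_inj rev_ord_inj) /=; apply: eq_bigr => i _.
by rewrite IH subSS subKn // -ltnS.
Qed.

Lemma wmulBl c1 c2 d w : wmul (c1 - c2) d w = wmul c1 d w - wmul c2 d w.
Proof.
elim: w c1 c2 d => [|a w IH] c1 c2 d /=; first by rewrite mulrBl.
by rewrite -sumrB; apply: eq_bigr => i _; rewrite -IH.
Qed.

Lemma wmulBr c d1 d2 w : wmul c (d1 - d2) w = wmul c d1 w - wmul c d2 w.
Proof. by rewrite wmulC wmulBl !(wmulC c). Qed.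

Definition wmul_in d w c := wmul c d w.

HB.instance Definition _ d w :=
  GRing.isZmodMorphism.Build (seq nat -> F) F (wmul_in d w)
    (fun c1 c2 => wmulBl c1 c2 d w).

(* [n] is fuel for the recursion on [a]; any [n >= a] gives the same value. *)
Fixpoint newton_rec n a c w : F :=
  if n is n'.+1 then
    c (a :: w) *+ a - \sum_(i < a) newton_rec n' i c ((a - i)%N :: w)
  else 0.

Definition newton a := newton_rec a a.

Lemma newton_rec_fuel n m a c w :
  (a <= n)%N -> (a <= m)%N -> newton_rec n a c w = newton_rec m a c w.
Proof.
elim: n m a w => [|n IH] m a w an am.
  by move: an am; rewrite leqn0 => /eqP->; case: m => //= m _;
    rewrite mulr0n big_ord0 subr0.
case: m am => [|m] am /=.
  by move: an am; rewrite leqn0 => _ /eqP->; rewrite mulr0n big_ord0 subr0.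
congr (_ - _); apply: eq_bigr => i _; apply: IH.
  by rewrite -ltnS (leq_trans (ltn_ord i)).
by rewrite -ltnS (leq_trans (ltn_ord i)).
Qed.

Lemma newtonE a c w :
  newton a c w = c (a :: w) *+ a - \sum_(i < a) newton i c ((a - i)%N :: w).
Proof.
case: a => [|a]; first by rewrite big_ord0 mulr0n subr0.
congr (_ - _); apply: eq_bigr => i _; apply: newton_rec_fuel => //.
by rewrite -ltnS.
Qed.

Lemma newton_cat a c u v : newton a c (u ++ v) = newton a (fun t => c (t ++ v)) u.
Proof.
elim/ltn_ind: a u => a IH u; rewrite !newtonE; congr (_ - _).
by apply: eq_bigr => i _; rewrite -IH.
Qed.

Lemma newton_is_additive a : zmod_morphism (newton a).
Proof.
move=> c d; apply/funext; elim/ltn_ind: a => a IH w.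
transitivity (newton a c w - newton a d w) => //.
rewrite !newtonE; under eq_bigr => i _ do rewrite IH //.
have -> : (c - d) (a :: w) = c (a :: w) - d (a :: w) by [].
by rewrite mulrnBl sumrB !opprD addrACA.
Qed.

HB.instance Definition _ a :=
  GRing.isZmodMorphism.Build (seq nat -> F) (seq nat -> F) (newton a)
    (newton_is_additive a).

Lemma zinv_newton a c : zinv c -> zinv (newton a c).
Proof.
move=> zc u v; rewrite !newton_cat; congr (newton a _ u).
by apply/funext => t; rewrite zc.
Qed.

Lemma newton_sum a c w : zinv c ->
  \sum_(i < a.+1) newton i c ((a - i)%N :: w) = c (a :: w) *+ a.
Proof.
move=> zc; rewrite big_ord_recr /= subnn (zinv_newton _ zc [::]) /=.
by rewrite newtonE addrC subrK.
Qed.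

Lemma big_triangle (V : nmodType) (G : nat -> nat -> V) a :
  \sum_(i < a.+1) \sum_(p < (a - i).+1) G i p =
  \sum_(s < a.+1) \sum_(i < s.+1) G i (s - i)%N.
Proof.
elim: a => [|a IH]; first by rewrite !big_ord1.
rewrite [RHS]big_ord_recr -IH [LHS]big_ord_recr /= subnn big_ord1.
rewrite [X in _ = _ + X]big_ord_recr /= subnn addrA -big_split /=; congr (_ + _).
by apply: eq_bigr => i _; rewrite subSn ?leq_ord // big_ord_recr.
Qed.

(** Regroup by the total [s] taken from the left factor, [i] by [newton i] and [s - i] by its share
    of the letter; Newton's identity [newton_sum] then yields the weight [s]. *)
Lemma wmul_newton_sum a c d w : zinv c ->
  \sum_(i < a.+1) wmul (newton i c) d ((a - i)%N :: w) =
  \sum_(s < a.+1) wmul (wcons s c) (wcons (a - s) d) w *+ s.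
Proof.
move=> zc.
pose G i p := wmul (wcons p (newton i c)) (wcons (a - i - p) d) w.
rewrite -/(\sum_(i < a.+1) \sum_(p < (a - i).+1) G i p) (big_triangle G).
apply: eq_bigr => s _.
have -> : wmul (wcons s c) (wcons (a - s) d) w *+ s =
    wmul_in (wcons (a - s) d) w (wcons s c *+ s) by rewrite raddfMn.
have -> : wcons s c *+ s = \sum_(i < s.+1) wcons (s - i) (newton i c).
  apply/funext => t; rewrite fct_sumE natmulfctE.
  by rewrite -[in LHS](newton_sum _ _ zc).
rewrite raddf_sum; apply: eq_bigr => i _; rewrite /G /wmul_in.
by rewrite -subnDA subnKC ?leq_ord.
Qed.

Lemma wmul_cons0 c d w : zinv c -> zinv d -> wmul c d (0%N :: w) = wmul c d w.
Proof. by move=> zc zd /=; rewrite big_ord1 !zinv_wcons0. Qed.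

(** Leibniz rule: the weight [a] of the first letter splits as [s + (a - s)] between the factors,
    which gives the two sums of [wmul_newton_sum]; induction removes the terms with [i < a]. *)
Lemma newton_wmul a c d w : zinv c -> zinv d ->
  newton a (wmul c d) w = wmul (newton a c) d w + wmul c (newton a d) w.
Proof.
move=> zc zd; elim/ltn_ind: a w => a IH w; rewrite newtonE.
have recr (G : nat -> F) : \sum_(i < a.+1) G i = \sum_(i < a) G i + G a.
  by rewrite big_ord_recr.
have ltE c1 d1 : zinv c1 -> zinv d1 ->
    \sum_(i < a) wmul (newton i c1) d1 ((a - i)%N :: w) =
    \sum_(s < a.+1) wmul (wcons s c1) (wcons (a - s) d1) w *+ s
      - wmul (newton a c1) d1 w.
  move=> zc1 zd1; rewrite -wmul_newton_sum //.
  rewrite (recr (fun i => wmul (newton i c1) d1 ((a - i)%N :: w))) subnn.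
  by rewrite wmul_cons0 ?addrK //; exact: zinv_newton.
under eq_bigr => i _ do rewrite IH // (wmulC c).
rewrite big_split !ltE // (wmulC c (newton a d)).
have -> : wmul c d (a :: w) *+ a =
    \sum_(s < a.+1) wmul (wcons s c) (wcons (a - s) d) w *+ s +
    \sum_(s < a.+1) wmul (wcons s d) (wcons (a - s) c) w *+ s.
  rewrite [X in _ = _ + X](reindex_inj rev_ord_inj) /= -big_split -sumrMnl.
  apply: eq_bigr => i _ /=; rewrite subSS subKn ?leq_ord // (wmulC (wcons _ d)).
  by rewrite -mulrnDr subnKC // -ltnS.
by rewrite opprD !opprB addrACA; congr (_ + _); rewrite addrC subrK.
Qed.

(** * Action at the right end and the coadjoint derivation *)

Definition newton_right a c : seq nat -> F :=
  fun u => newton a (fun t => c (u ++ t)) [::].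

Lemma newton_right_is_additive a : zmod_morphism (newton_right a).
Proof.
move=> c d; apply/funext => u; rewrite {1}/newton_right.
rewrite (_ : (fun t => _) = (fun t => c (u ++ t)) - (fun t => d (u ++ t))) //.
by rewrite raddfB.
Qed.

HB.instance Definition _ a :=
  GRing.isZmodMorphism.Build (seq nat -> F) (seq nat -> F) (newton_right a)
    (newton_right_is_additive a).

Lemma zinv_newton_right a c : zinv c -> zinv (newton_right a c).
Proof.
move=> zc u v; congr (newton a _ _); apply/funext => t.
by rewrite -!catA /= zc.
Qed.

Lemma zinv_wcons a c : zinv c -> zinv (wcons a c).
Proof. by move=> zc u v; exact: (zc (a :: u)). Qed.

Lemma newton_right_wmul a c d u : zinv c -> zinv d ->
  newton_right a (wmul c d) u =
  wmul (newton_right a c) d u + wmul c (newton_right a d) u.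
Proof.
elim: u c d => [|b u IH] c d zc zd; first exact: newton_wmul.
have -> : newton_right a (wmul c d) (b :: u) =
    newton_right a (\sum_(i < b.+1) wmul (wcons i c) (wcons (b - i) d)) u.
  by congr (newton a _ _); apply/funext => t; rewrite fct_sumE.
rewrite raddf_sum fct_sumE -big_split; apply: eq_bigr => i _.
apply: etrans (IH _ _ _ _) _ => //; exact: zinv_wcons.
Qed.

(* The coadjoint action of the primitive functional [newton a]; unlike
   [newton a] itself it does not create constant terms. *)
Definition coad a c : seq nat -> F := newton_right a c - newton a c.

Lemma coad_is_additive a : zmod_morphism (coad a).
Proof.
move=> c d; rewrite /coad (raddfB (newton_right a)) (raddfB (newton a)).
by rewrite !opprD addrACA.
Qed.

HB.instance Definition _ a :=
  GRing.isZmodMorphism.Build (seq nat -> F) (seq nat -> F) (coad a)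
    (coad_is_additive a).

Lemma zinvB c d : zinv c -> zinv d -> zinv (c - d).
Proof. by move=> zc zd u v; rewrite !fctE zc zd. Qed.

Lemma zinv_coad a c : zinv c -> zinv (coad a c).
Proof.
by move=> zc; apply: zinvB; [exact: zinv_newton_right | exact: zinv_newton].
Qed.

Lemma coad_nil a c : coad a c [::] = 0.
Proof. exact: subrr. Qed.

Lemma coad_wmul a c d : zinv c -> zinv d ->
  coad a (wmul c d) = wmul (coad a c) d + wmul c (coad a d).
Proof.
move=> zc zd; apply/funext => u.
transitivity (newton_right a (wmul c d) u - newton a (wmul c d) u) => //.
by rewrite newton_wmul // newton_right_wmul // opprD addrACA -wmulBl -wmulBr.
Qed.

Definition kills_products (lam : (seq nat -> F) -> F) :=
  forall c d, zinv c -> zinv d -> c [::] = 0 -> d [::] = 0 -> lam (wmul c d) = 0.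

Lemma kills_products_newton a : kills_products (fun c => newton a c [::]).
Proof.
by move=> c d zc zd c0 d0; rewrite newton_wmul //= c0 d0 mulr0 mul0r addr0.
Qed.

(** Values of the derivation [coad a] vanish at the empty word, so both Leibniz terms are again
    products of functions without constant term. *)
Lemma kills_products_coad a (lam : {additive (seq nat -> F) -> F}) :
  kills_products lam -> kills_products (lam \o coad a).
Proof.
move=> kl c d zc zd c0 d0; rewrite /= coad_wmul // raddfD.
by rewrite !kl ?addr0 ?coad_nil //; exact: zinv_coad.
Qed.

End WordFunctions.

(** * Order ideals *)

Section Ideals.
Variables (disp : Order.disp_t) (P : finPOrderType disp).
Implicit Types (W I J B : {set P}) (w u v : seq nat).

Definition is_ideal W I :=
  (I \subset W) && [forall x in I, forall y in W, (y <= x)%O ==> (y \in I)].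

Lemma is_idealP W I :
  reflect (I \subset W /\ forall x y, x \in I -> y \in W -> (y <= x)%O -> y \in I)
          (is_ideal W I).
Proof.
apply: (iffP andP) => -[IW H]; split=> //.
  move=> x y xI yW; apply/implyP.
  by move/forall_inP: H => /(_ x xI) /forall_inP; exact.
by apply/forall_inP => x xI; apply/forall_inP => y yW; apply/implyP; exact: H.
Qed.

(* The number of order-preserving maps on [W] with content [w], counted by
   splitting off the fibre over the first letter. *)
Fixpoint npart W w : nat :=
  if w is a :: w' then
    (\sum_(I : {set P} | is_ideal W I && (#|I| == a)) npart (W :\: I) w')%N
  else (W == set0).

Lemma is_ideal0 W : is_ideal W set0.
Proof. by apply/is_idealP; split; [exact: sub0set | move=> x y; rewrite inE]. Qed.

Lemma is_ideal_sub W I : is_ideal W I -> I \subset W.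
Proof. by case/andP. Qed.

Lemma npart_cons0 W w : npart W (0%N :: w) = npart W w.
Proof.
rewrite /= (big_pred1 set0) ?setD0 // => I.
by rewrite cards_eq0 /= andbC; case: eqP => // ->; rewrite is_ideal0.
Qed.

Lemma npart_cat0 W u v : npart W (u ++ 0%N :: v) = npart W (u ++ v).
Proof.
elim: u W => [|a u IH] W; first exact: npart_cons0.
by apply: eq_bigr => I _; exact: IH.
Qed.

Lemma npart_sumn W w : (0 < npart W w)%N -> sumn w = #|W|.
Proof.
elim: w W => [|a w IH] W /=; first by rewrite lt0b => /eqP->; rewrite cards0.
rewrite lt0n sum_nat_eq0 => /forall_inPn /= [I /andP[/is_ideal_sub IW /eqP <-]].
by rewrite -lt0n => /IH->; rewrite cardsD (setIidPr IW) subnKC // subset_leq_card.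
Qed.

Lemma is_idealDK W I J : is_ideal W J ->
  J \subset I -> is_ideal (W :\: J) (I :\: J) = is_ideal W I.
Proof.
move=> /is_idealP[JW dJ] JI; apply/is_idealP/is_idealP => -[IW dI].
  split=> [|x y xI yW yx].
    by rewrite -(setID I J) subUset (subset_trans _ JW) ?subsetIr //
       (subset_trans IW) ?subsetDl.
  have [xJ|xJ] := boolP (x \in J); first exact: (subsetP JI) (dJ x y xJ yW yx).
  have [/(subsetP JI)//|yJ] := boolP (y \in J).
  by have := dI x y; rewrite !inE xJ yJ xI yW => /(_ isT isT yx).
split=> [|x y]; first exact: setSD.
rewrite !inE => /andP[_ xI] /andP[-> yW] yx; exact: dI yx.
Qed.

Lemma sum_ideal_setD (V : nmodType) W J (f : {set P} -> V) : is_ideal W J ->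
  \sum_(I | is_ideal (W :\: J) I) f I =
  \sum_(I | is_ideal W I && (J \subset I)) f (I :\: J).
Proof.
move=> iJ.
rewrite (reindex_onto (fun I => I :\: J) (fun I => I :|: J)) /=.
  apply: eq_bigl => I; have [JI|nJI] := boolP (J \subset I).
    by rewrite is_idealDK // setUC -[X in X :|: _](setIidPr JI) setID eqxx.
  rewrite andbF; apply/negP => /andP[_ /eqP IE]; case/negP: nJI.
  by rewrite -IE subsetUr.
move=> I /is_ideal_sub; rewrite subsetD => /andP[_ dIJ].
by rewrite setDUl setDv setU0; apply/setDidPl.
Qed.

Lemma is_ideal_trans W I J : is_ideal W I ->
  is_ideal I J = is_ideal W J && (J \subset I).
Proof.
move=> /is_idealP[IW dI]; apply/is_idealP/andP => [[JI dJ]|[/is_idealP[JW dJ] JI]].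
  split=> //; apply/is_idealP; split=> [|x y xJ yW yx].
    exact: subset_trans IW.
  by apply: (dJ x) => //; exact: dI (subsetP JI _ xJ) yW yx.
by split=> // x y xJ yI; apply: dJ => //; exact: (subsetP IW).
Qed.

Lemma setDD_sub W I J : J \subset I -> W :\: J :\: (I :\: J) = W :\: I.
Proof. by move=> JI; rewrite setDDl -[X in X :|: _](setIidPr JI) setID. Qed.

(** The fibres over the letters of [u] together form an ideal. This is the coproduct of K_W on
    words. *)
Lemma npart_cat W u v :
  npart W (u ++ v) = (\sum_(I | is_ideal W I) npart I u * npart (W :\: I) v)%N.
Proof.
elim: u W => [|a u IH] W /=.
  rewrite (bigD1 set0) ?is_ideal0 //= eqxx mul1n setD0 big1 ?addn0 // => I.
  by case/andP => _ /negPf->.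
transitivity (\sum_(J | is_ideal W J && (#|J| == a))
  \sum_(I | is_ideal W I && (J \subset I)) npart (I :\: J) u * npart (W :\: I) v)%N.
  apply: eq_bigr => J /andP[iJ _].
  rewrite IH (sum_ideal_setD (fun I => npart I u * npart (W :\: J :\: I) v)%N iJ).
  by apply: eq_bigr => I /andP[_ JI]; rewrite setDD_sub.
rewrite (exchange_big_dep (is_ideal W)) /= => [|J I _ /andP[]//].
apply: eq_bigr => I iI; rewrite big_distrl /=; apply: eq_bigl => J.
by rewrite (is_ideal_trans _ iI) iI /= andbAC.
Qed.

Definition pideal W x : {set P} := [set y in W | (y <= x)%O].

Lemma pideal_ideal W x : is_ideal W (pideal W x).
Proof.
apply/is_idealP; split=> [|y z]; first by apply/subsetP => y; rewrite inE => /andP[].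
by rewrite !inE => /andP[_ yx] -> zy; exact: le_trans yx.
Qed.

Lemma pideal_subset W I x : is_ideal W I -> x \in W ->
  (pideal W x \subset I) = (x \in I).
Proof.
move=> /is_idealP[IW dI] xW; apply/subsetP/idP => [|xI y].
  by apply; rewrite inE xW lexx.
by rewrite inE => /andP[yW yx]; exact: dI yx.
Qed.

(** Double counting of a lowest fibre [I] of size [a] with a marked [x] in [I]: such an [I] contains
    [pideal W x], whose removal leaves an ideal of size [a - i]. *)
Lemma npart_newton W a w :
  (\sum_(i < a.+1) \sum_(x in W | #|pideal W x| == i)
     npart (W :\: pideal W x) ((a - i)%N :: w) = npart W (a :: w) * a)%N.
Proof.
transitivity (\sum_(x in W) \sum_(I | is_ideal W I && (#|I| == a) && (x \in I))
   npart (W :\: I) w)%N; last first.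
  rewrite (exchange_big_dep (fun I => is_ideal W I && (#|I| == a))) /=; last first.
    by move=> x I _ /andP[].
  rewrite big_distrl /=; apply: eq_bigr => I /andP[iI /eqP cI].
  have IW := is_ideal_sub iI; rewrite (eq_bigl (fun x => x \in I)) => [|x]; last first.
    by rewrite cI iI eqxx; case: (boolP (x \in I)) => [/(subsetP IW)->|]; rewrite ?andbF.
  by rewrite sum_nat_const cI mulnC.
rewrite (exchange_big_dep (fun x => x \in W)) /= => [|i x _ /andP[]//].
apply: eq_bigr => x xW.
have [le_xa|lt_ax] := leqP #|pideal W x| a; last first.
  rewrite !big1 // => [I /andP[/andP[iI /eqP cI] xI]|i /andP[_ /eqP ix]].
    by move: lt_ax; rewrite -cI ltnNge subset_leq_card // (pideal_subset iI).
  by move: lt_ax; rewrite ix ltnNge leq_ord.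
have lt_xa : (#|pideal W x| < a.+1)%N by [].
rewrite (big_pred1 (Ordinal lt_xa)) => [|i]; last first.
  by rewrite xW /= eq_sym -val_eqE.
have iD := pideal_ideal W x.
rewrite big_mkcondr (sum_ideal_setD (fun I =>
  if #|I| == (a - #|pideal W x|)%N then npart (W :\: pideal W x :\: I) w else 0%N) iD).
rewrite [RHS]big_mkcondr [RHS]big_mkcondr [LHS]big_mkcondr /=.
apply: eq_bigr => I iI; rewrite (pideal_subset iI xW); case: ifP; last by case: ifP.
move=> xI; have DI : pideal W x \subset I by rewrite (pideal_subset iI).
rewrite setDD_sub // cardsD (setIidPr DI) eqn_sub2rE //.
exact: subset_leq_card.
Qed.
End Ideals.

(** * The functional *)

Section Functional.
Variables (F : numDomainType) (disp : Order.disp_t) (P : finPOrderType disp).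
Implicit Types (W I J B : {set P}) (w u v : seq nat).

Definition kpart W : seq nat -> F := fun w => (npart W w)%:R.

Lemma zinv_kpart W : zinv (kpart W).
Proof. by move=> u v; rewrite /kpart npart_cat0. Qed.

(** The Newton recursion and [npart_newton] share the terms with [i < a]; only [i = a] remains,
    where the letter [a - i] is zero and drops out. *)
Lemma newton_kpart a W w :
  newton a (kpart W) w =
  \sum_(x in W | #|pideal W x| == a) kpart (W :\: pideal W x) w.
Proof.
elim/ltn_ind: a w => a IH w; rewrite newtonE.
have -> : kpart W (a :: w) *+ a = (npart W (a :: w) * a)%:R.
  by rewrite natrM mulr_natr.
rewrite -npart_newton natr_sum.
have recr (G : nat -> F) : \sum_(i < a.+1) G i = \sum_(i < a) G i + G a.
  by rewrite big_ord_recr.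
pose G i : F := \sum_(x in W | #|pideal W x| == i)
  kpart (W :\: pideal W x) ((a - i)%N :: w).
rewrite (eq_bigr (fun i => G (val i))) => [|i _]; last by rewrite natr_sum.
rewrite recr [X in _ - X](eq_bigr (fun i => G (val i))) => [|i _]; last exact: IH.
rewrite addrC addKr; apply: eq_bigr => x _.
by rewrite subnn /kpart npart_cons0.
Qed.

(** Equals 1 if [B] has [a] elements and a maximum, and 0 otherwise: a maximum is unique by
    antisymmetry. *)
Definition ntop a B : nat :=
  #|[set x in B | (#|pideal B x| == a) && (B \subset pideal B x)]|.

Lemma ntop_gt0P a B :
  reflect (#|B| = a /\ exists2 x, x \in B & B \subset pideal B x) (0 < ntop a B)%N.
Proof.
have dB x : B \subset pideal B x -> pideal B x = B.
  by move=> Bx; apply/eqP; rewrite eqEsubset Bx (is_ideal_sub (pideal_ideal B x)).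
apply: (iffP card_gt0P) => [[x]|[cB [x xB Bx]]].
  by rewrite inE => /and3P[xB /eqP cx Bx]; split; [rewrite -cx dB | exists x].
by exists x; rewrite inE xB Bx dB // cB eqxx.
Qed.

Lemma newton_kpart_nil a B : newton a (kpart B) [::] = (ntop a B)%:R.
Proof.
rewrite newton_kpart /kpart -natr_sum /ntop cardE /=; congr _%:R.
rewrite -cardE -sum1_card big_mkcond [RHS]big_mkcond; apply: eq_bigr => x _.
rewrite !inE setD_eq0; case: (x \in B) => //=.
by case: (_ == a) => //=; case: (B \subset _).
Qed.

(** The primitive functional is applied to the lower half of the coproduct [npart_cat]. Summing over
    ideals makes the result comparable with [newton_right_kpart], which uses the upper half. *)
Lemma newton_kpart_ideals a W :
  newton a (kpart W) = \sum_(I | is_ideal W I) kpart (W :\: I) *+ ntop a I.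
Proof.
apply/funext => v; rewrite -[v in LHS]cat0s newton_cat.
have -> : (fun t => kpart W (t ++ v)) =
    \sum_(I | is_ideal W I) kpart I *+ npart (W :\: I) v.
  apply/funext => t; rewrite /kpart npart_cat natr_sum fct_sumE.
  by apply: eq_bigr => I _; rewrite natmulfctE natrM mulr_natr.
rewrite raddf_sum !fct_sumE; apply: eq_bigr => I _.
rewrite raddfMn !natmulfctE [X in X *+ _]newton_kpart_nil /kpart.
by rewrite -!mulrnA mulnC.
Qed.

Lemma newton_right_kpart a W :
  newton_right a (kpart W) = \sum_(I | is_ideal W I) kpart I *+ ntop a (W :\: I).
Proof.
apply/funext => u; rewrite /newton_right.
have -> : (fun t => kpart W (u ++ t)) =
    \sum_(I | is_ideal W I) kpart (W :\: I) *+ npart I u.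
  apply/funext => t; rewrite /kpart npart_cat natr_sum fct_sumE.
  by apply: eq_bigr => I _; rewrite natmulfctE natrM mulr_natl.
rewrite raddf_sum !fct_sumE; apply: eq_bigr => I _.
rewrite raddfMn !natmulfctE [X in X *+ _]newton_kpart_nil /kpart.
by rewrite -!mulrnA mulnC.
Qed.

(* [n W] is the number of ways to build [W] from the blocks whose sizes are
   encoded in [lam]; [r] is the total size of the blocks. *)
Definition counts_ideals (lam : (seq nat -> F) -> F) (r : nat) :=
  exists n : {set P} -> nat,
    [/\ forall W, lam (kpart W) = (n W)%:R,
        forall W, (0 < n W)%N -> [/\ is_ideal setT W, W != set0 & #|W| = r]
      & exists W, (0 < n W)%N].

(** The letter is the size of a largest principal ideal. A set of that size with maximum [y] lies in
    the principal ideal of [y], which is no larger, so the two coincide. *)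
Lemma counts_ideals_newton : (0 < #|P|)%N ->
  exists a, counts_ideals (fun c => newton a c [::]) a.
Proof.
move=> /card_gt0P[x0 _]; pose D (x : P) : {set P} := pideal setT x.
have [x _ maxx] := @arg_maxnP _ x0 xpredT (fun x => #|D x|) isT.
exists #|D x|, (ntop #|D x|); split=> [W|W|].
- exact: newton_kpart_nil.
- move=> /ntop_gt0P[cW [y yW Wy]]; split=> //; last by apply/set0Pn; exists y.
  have -> : W = D y; last exact: pideal_ideal.
  apply/eqP; rewrite eqEcard cW; apply/andP; split; last exact: maxx.
  by apply/subsetP => z /(subsetP Wy); rewrite !inE => /andP[].
- exists (D x); apply/ntop_gt0P; split=> //; exists x; first by rewrite !inE lexx.
  by apply/subsetP => y yx; rewrite inE yx; move: yx; rewrite inE => /andP[].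
Qed.

(** Without such a [b] the ideal [W] would also be closed upwards; no Hasse edge would leave it, and
    connectedness would make it all of [P]. *)
Lemma connected_ideal_ext W : poset_connected P -> is_ideal setT W ->
  W != set0 -> (#|W| < #|P|)%N ->
  exists2 b, b \notin W & pideal setT b :&: W != set0.
Proof.
move=> conP iW /set0Pn[x xW] cW.
have [/existsP[b /andP[bW bD]]|] :=
  boolP [exists b, (b \notin W) && (pideal setT b :&: W != set0)]; first by exists b.
rewrite negb_exists => /forallP noext; move/is_idealP: iW => [_ dW].
have up p q : p \in W -> (p <= q)%O -> q \in W.
  move=> pW pq; have := noext q; rewrite negb_and !negbK => /orP[//|/eqP E].
  by have := in_set0 p; rewrite -E !inE pq pW.
have closedW : closed (fun p q : P => covers p q || covers q p) (mem W).
  move=> p q /orP[] /andP[/ltW pq _]; apply/idP/idP => H.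
  - exact: up pq.
  - by apply: dW pq; rewrite ?inE.
  - by apply: dW pq; rewrite ?inE.
  - exact: up pq.
move: cW; rewrite ltnNge => /negP[]; apply: subset_leq_card; apply/subsetP => y _.
by rewrite -(closed_connect closedW (conP x y)).
Qed.

Lemma counts_ideals_coad (lam : {additive (seq nat -> F) -> F}) r :
  poset_connected P -> (r < #|P|)%N -> counts_ideals lam r ->
  exists2 a, (0 < a)%N & counts_ideals (lam \o coad a) (r + a).
Proof.
move=> conP lt_r [n [lamE nW [W0 nW0]]].
(* The new letter [a] is the largest number of elements that can be gained by
   adjoining to a set of positive count a principal ideal meeting it. *)
pose adm (p : {set P} * P) := [&& (0 < n p.1)%N, p.2 \notin p.1
  & pideal setT p.2 :&: p.1 != set0].
pose gain (p : {set P} * P) := #|pideal setT p.2 :\: p.1|.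
have [p0 adm0] : exists p, adm p.
  have [iW0 W0n0 cW0] := nW _ nW0.
  rewrite -cW0 in lt_r; have [b bW bD] := connected_ideal_ext conP iW0 W0n0 lt_r.
  by exists (W0, b); rewrite /adm /= nW0 bW.
case: (arg_maxnP gain adm0) => -[V b] /and3P[/= nV bV bD] maxVb.
pose a := gain (V, b); exists a.
  by apply/card_gt0P; exists b; rewrite !inE bV lexx.
(* If [I] and its complement in [W] are both ideals, the block can be detached from the top and from
   the bottom, and the two contributions cancel. *)
pose n' W := (\sum_(I | is_ideal W I && ~~ is_ideal W (W :\: I))
  n I * ntop a (W :\: I))%N.
exists n'; split=> [W|W|].
- have lamMn (I : {set P}) m : lam (kpart I *+ m) = (n I * m)%:R.
    by rewrite raddfMn lamE natrM mulr_natr.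
  have -> : (lam \o coad a) (kpart W) =
      \sum_(I | is_ideal W I) (n I * ntop a (W :\: I))%:R -
      \sum_(I | is_ideal W I) (n (W :\: I) * ntop a I)%:R.
    rewrite /= /coad raddfB newton_right_kpart newton_kpart_ideals !(raddf_sum lam).
    by congr (_ - _); apply: eq_bigr => I _; rewrite lamMn.
  rewrite (bigID (fun I => is_ideal W (W :\: I))) /= addrAC.
  rewrite [X in X + _ = _](_ : _ = 0); first by rewrite add0r -natr_sum.
  apply/eqP; rewrite subr_eq0; apply/eqP.
  (* Complementation moves the negative sum to those [I] with [W :\: I] an ideal. If [n I] is
     positive, [I] is an ideal of [P], hence of [W], so every negative term is cancelled. *)
  rewrite [RHS](reindex_onto (fun I => W :\: I) (fun I => W :\: I)) /=; last first.
    by move=> I /is_ideal_sub IW; rewrite setDDr setDv set0U; apply/setIidPr.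
  rewrite big_mkcond [RHS]big_mkcond; apply: eq_bigr => I _.
  have [IW|nIW] := boolP (I \subset W); last first.
    rewrite (contraNF (@is_ideal_sub _ _ W I) nIW) /=; case: ifP => // /andP[_ /eqP E].
    by case/negP: nIW; rewrite -E subsetDl.
  have -> : W :\: (W :\: I) = I by rewrite setDDr setDv set0U; apply/setIidPr.
  rewrite eqxx andbT; case: (posnP (n I)) => [->|/nW[iI _ _]].
    by rewrite mul0n; do 2 case: ifP.
  suff -> : is_ideal W I by [].
  case/is_idealP: iI => _ dI; apply/is_idealP; split=> // x y xI yW.
  exact: dI.
- rewrite lt0n sum_nat_eq0 => /forall_inPn /= [I /andP[iWI niWI]].
  rewrite -lt0n muln_gt0 => /andP[nI /ntop_gt0P[cB [y yB By]]].
  have [iI In0 cI] := nW I nI; have IW := is_ideal_sub iWI.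
  move/is_idealP: (iI) => [_ dI].
  have yI : y \notin I by move: yB; rewrite !inE => /andP[].
  have yW : y \in W by move: yB; rewrite !inE => /andP[].
  have ley x : x \in W :\: I -> (x <= y)%O.
    by move/(subsetP By); rewrite inE => /andP[].
  (* If the principal ideal of [y] missed [I], the block [W :\: I] would be an ideal of [W]. So
     [(I, y)] is admissible, its gain is at most [a], and the inclusion of the block, of size [a],
     is an equality. *)
  have BD : W :\: I = pideal setT y :\: I.
    apply/eqP; rewrite eqEcard cB; apply/andP; split.
      by apply/subsetP => x xWI; move: (xWI); rewrite !inE ley // => /andP[->].
    apply: (maxVb (I, y)); rewrite /adm /= nI yI /=.
    apply: contraNneq niWI => E; apply/is_idealP; split=> [|x z xB zW zx].
      exact: subsetDl.
    rewrite inE zW andbT; apply/negP => zI; have := in_set0 z.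
    by rewrite -E !inE zI (le_trans zx (ley _ xB)).
  have WE : W = I :|: pideal setT y.
    rewrite -{1}(setID W I) (setIidPr IW) BD; apply/setP => x.
    by rewrite !inE; case: (x \in I).
  split; last by rewrite -cI -cB cardsD (setIidPr IW) subnKC // subset_leq_card.
    apply/is_idealP; split=> [|x z]; first exact: subsetT.
    rewrite WE !inE => /orP[xI zT zx|xy _ zx]; first by rewrite (dI x).
    by rewrite (le_trans zx xy) orbT.
  by apply/set0Pn; exists y.
(* The maximizing pair itself has positive count: the block added to [V] has maximum [b], and an
   element of [V] below [b] keeps it from being an ideal. *)
- have [iV Vn0 cV] := nW V nV.
  exists (V :|: pideal setT b); rewrite lt0n sum_nat_eq0; apply/forall_inPn => /=.
  have BE : (V :|: pideal setT b) :\: V = pideal setT b :\: V.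
    by rewrite setDUl setDv set0U.
  move/is_idealP: (iV) => [_ dV].
  exists V; last first.
    rewrite BE -lt0n muln_gt0 nV /=; apply/ntop_gt0P; split=> //.
    exists b; first by rewrite !inE bV lexx.
    by apply/subsetP => x xB; rewrite inE xB; move: xB; rewrite !inE => /andP[].
  rewrite unfold_in BE; apply/andP; split.
    apply/is_idealP; split=> [|x y xV _]; first exact: subsetUl.
    by apply: dV => //; rewrite inE.
  apply/is_idealP => -[_ dB]; case/set0Pn: bD => z; rewrite !inE => /andP[zb zV].
  by have := dB b z; rewrite !inE bV lexx zV => /(_ isT isT zb).
Qed.

(** Letters are added by [coad] until the total size is that of [P]. The only subset of that size is
    [P], so the positive count belongs to it. *)
Lemma exists_functional : (0 < #|P|)%N -> poset_connected P ->
  exists2 lam : {additive (seq nat -> F) -> F},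
    kills_products lam & lam (kpart setT) != 0.
Proof.
move=> P0 conP.
suff [lam kl [n [lamE nW [W nW0]]]] : exists2 lam : {additive (seq nat -> F) -> F},
    kills_products lam & counts_ideals lam #|P|.
  exists lam => //; rewrite lamE pnatr_eq0 -lt0n.
  have [_ _ cW] := nW _ nW0.
  by have /eqP <- : W == setT by rewrite eqEcard subsetT cardsT cW /=.
have [a0 ca0] := counts_ideals_newton P0.
pose ev c : F := newton a0 c [::].
have ev_add : zmod_morphism ev by move=> c d; rewrite /ev raddfB.
pose evM := GRing.isZmodMorphism.Build _ _ ev ev_add.
pose evA : {additive (seq nat -> F) -> F} := HB.pack ev evM.
have : exists2 lam : {additive (seq nat -> F) -> F},
    kills_products lam & counts_ideals lam a0.
  by exists evA; first exact: kills_products_newton.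
move: a0 {ca0 ev ev_add evM evA} => r [lam kl cl].
have [m] := ubnP (#|P| - r)%N; elim: m r lam kl cl => // m IH r lam kl cl lt_m.
have [le_r|lt_r] := leqP #|P| r.
  exists lam => //; case: cl => n [lamE nW [W nW0]].
  exists n; split=> //; last by exists W.
  move=> V /nW[iV V0 cV]; split=> //; apply/eqP; rewrite eqn_leq max_card cV.
  by rewrite le_r.
have [a a0 ca] := counts_ideals_coad conP lt_r cl.
apply: (IH (r + a)%N (lam \o coad a : {additive _ -> _})) => //.
  exact: kills_products_coad.
by rewrite -ltnS (leq_trans _ lt_m) // ltnS subnDA ltn_subrL a0 subn_gt0.
Qed.
End Functional.

(** * Supports of products *)

Section Degrees.
Variable F : idomainType.
Implicit Types (c d : seq nat -> F) (w u v : seq nat).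

Lemma wmul_eq0 c d w :
  (forall u, size u = size w -> (sumn u <= sumn w)%N -> c u = 0) -> wmul c d w = 0.
Proof.
elim: w c d => [|a w IH] c d c0 /=; first by rewrite c0 // mul0r.
apply: big1 => i _; apply: IH => u su le_uw; apply: c0 => /=; first by rewrite su.
by rewrite leq_add ?leq_ord.
Qed.

(** A split of [w] contributes only if [c] receives all of it; [d] is then evaluated at a zero
    word. *)
Lemma wmul_lowest c d w :
  (forall u, size u = size w -> (sumn u < sumn w)%N -> c u = 0) ->
  wmul c d w = c w * d (nseq (size w) 0%N).
Proof.
elim: w c d => [|a w IH] c d c0 //=; rewrite big_ord_recr /= subnn big1 ?add0r.
  by rewrite IH // => u su lt_uw; apply: c0; rewrite /= ?su // ltn_add2l.
move=> i _; apply: wmul_eq0 => u su le_uw; apply: c0 => /=; first by rewrite su.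
by rewrite -addSn leq_add.
Qed.

Definition wbounded c := exists b, forall w, c w != 0 -> (sumn w <= b)%N.

Lemma wbounded_wcons a c : wbounded c -> wbounded (wcons a c).
Proof.
move=> [b cb]; exists b => w /cb /=; exact: leq_trans (leq_addl _ _).
Qed.

Lemma leading_letter c n : wbounded c ->
  (exists2 u, size u = n.+1 & c u != 0) ->
  exists a, (exists2 u, size u = n & wcons a c u != 0) /\
    forall i, (a < i)%N -> forall u, size u = n -> wcons i c u = 0.
Proof.
move=> [b cb] [[//|a0 u0] [su0] cu0].
pose Q a := `[< exists2 u, size u = n & wcons a c u != 0 >].
have exQ : exists a, Q a by exists a0; apply/asboolP; exists u0.
have Qb a : Q a -> (a <= b)%N.
  by move=> /asboolP[u _ /cb /=]; exact: leq_trans (leq_addr _ _).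
have [a /asboolP Qa maxa] := ex_maxnP exQ Qb; exists a; split=> // i lt_ai u su.
apply/eqP; apply: contraTT lt_ai => cu; rewrite -leqNgt; apply: maxa.
by apply/asboolP; exists u.
Qed.

(* The lexicographically largest words of a given length in the supports of
   the two factors contribute the only term to the coefficient of their sum. *)
Lemma wmul_leading n c d : wbounded c -> wbounded d ->
  (exists2 u, size u = n & c u != 0) -> (exists2 v, size v = n & d v != 0) ->
  exists u v w, [/\ c u != 0, wmul c d w != 0, size w = n, sumn w = (sumn u + sumn v)%N
    & forall v', size v' = n -> d v' != 0 -> sumn v = 0%N -> sumn v' = 0%N].
Proof.
elim: n c d => [|n IH] c d bc bd exc exd.
  case: exc exd => u /size0nil-> cu [v /size0nil-> dv].
  by exists [::], [::], [::]; split=> //=; [rewrite mulf_neq0 | case].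
have [a [exa maxa]] := leading_letter bc exc.
have [b [exb maxb]] := leading_letter bd exd.
have [u [v [w [cu cdw sz_w sw maxv]]]] :=
  IH _ _ (wbounded_wcons a bc) (wbounded_wcons b bd) exa exb.
exists (a :: u), (b :: v), ((a + b)%N :: w); split=> //=.
- have lt_ab : (a < (a + b).+1)%N by rewrite ltnS leq_addr.
  rewrite (bigD1 (Ordinal lt_ab)) //= addKn big1 ?addr0 // => i ne_ia.
  have [lt_ia|lt_ai|ia] := ltngtP i a.
  + rewrite wmulC; apply: wmul_eq0 => t st _; apply: maxb; last by rewrite st.
    by rewrite -addnBAC ?(ltnW lt_ia) // -[X in (X < _)%N]add0n ltn_add2r subn_gt0.
  + by apply: wmul_eq0 => t st _; apply: maxa; rewrite // st.
  + by case/eqP: ne_ia; apply: val_inj.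
- by rewrite sz_w.
- by rewrite sw addnACA.
- case=> //= b' v' [sv'] dv' /eqP; rewrite addn_eq0 => /andP[/eqP b0 /eqP v0].
  have b'0 : b' = 0%N.
    apply/eqP; rewrite -leqn0 -b0 leqNgt; apply/negP => lt_bb'.
    by move/eqP: dv'; apply; exact: maxb lt_bb' _ sv'.
  by rewrite b'0 maxv // b0 -b'0.
Qed.

Lemma wmul_homogeneous_nil n c d : zinv c -> zinv d -> wbounded c -> wbounded d ->
  (forall w, wmul c d w != 0 -> sumn w = n) ->
  (exists u, c u != 0) -> (exists2 v, (0 < sumn v)%N & d v != 0) -> d [::] = 0.
Proof.
move=> zc zd bc bd hom exc [v0 v0_gt0 dv0]; apply/eqP; apply/negPn/negP => d0.
have low u : c u != 0 -> (n <= sumn u)%N.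
  move=> cu; pose Q m := `[< exists2 t, sumn t = m & c t != 0 >].
  have exQ : exists m, Q m by exists (sumn u); apply/asboolP; exists u.
  have [m /asboolP[t <- ct] minm] := ex_minnP exQ.
  have <- : sumn t = n.
    apply: hom; rewrite wmul_lowest.
      by rewrite mulf_neq0 // -(cat0s (nseq _ _)) zinv_pad.
    move=> s _ lt_st; apply/eqP; apply: contraTT lt_st => cs; rewrite -leqNgt.
    by apply: minm; apply/asboolP; exists s.
  by apply: minm; apply/asboolP; exists u.
(* Zero padding provides the witnesses of equal length that [wmul_leading] requires. *)
have [u0 cu0] := exc; pose N := (size u0 + size v0)%N.
have [||u [v [w [cu cdw _ sw maxv]]]] := @wmul_leading N c d bc bd.
- by exists (u0 ++ nseq (size v0) 0%N); rewrite ?size_cat ?size_nseq ?zinv_pad.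
- exists (v0 ++ nseq (size u0) 0%N); rewrite ?size_cat ?size_nseq ?zinv_pad //.
  by rewrite addnC.
- have := hom _ cdw; rewrite sw => E; have := low _ cu; rewrite -E.
  rewrite -[X in (_ <= X)%N]addn0 leq_add2l leqn0 => /eqP v_0.
  have := maxv (v0 ++ nseq (size u0) 0%N); rewrite size_cat size_nseq addnC.
  rewrite zinv_pad // => /(_ erefl dv0 v_0) /eqP; rewrite sumn_cat sumn_nseq addn0.
  by rewrite eqn0Ngt v0_gt0.
Qed.

End Degrees.

(** * Coefficients of power series *)

Section Monomials.
Implicit Types (w u v : seq nat) (m : monom).

Definition monw w : monom :=
  [fsfun i in [fset j in iota 0 (size w)]%fset => nth 0%N w i | 0%N].

Lemma monwE w i : monw w i = nth 0%N w i.
Proof.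
rewrite fsfunE inE /= mem_iota add0n /=.
by case: ltnP => // le_wi; rewrite nth_default.
Qed.

Definition wsupp w := [seq i <- iota 0 (size w) | nth 0%N w i != 0%N].
Definition wparts w := [seq a <- w | a != 0%N].

Lemma wpartsE w : wparts w = [seq nth 0%N w i | i <- wsupp w].
Proof. by rewrite /wparts -{1}(mkseq_nth 0%N w) /mkseq filter_map. Qed.

Lemma mem_wsupp w i : (i \in wsupp w) = (nth 0%N w i != 0%N).
Proof.
rewrite mem_filter mem_iota add0n /=; case: ltnP => [|le_wi]; first by rewrite andbT.
by rewrite nth_default.
Qed.

Lemma monw_monom_of w : monw w = monom_of (wsupp w) (wparts w).
Proof.
apply/fsfunP => i; rewrite monwE fsfunE inE /= mem_wsupp.
case: ifP => [ni|/negbFE/eqP->//]; rewrite wpartsE (nth_map 0%N) ?nth_index //.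
  by rewrite mem_wsupp.
by rewrite index_mem mem_wsupp.
Qed.

Lemma sorted_wsupp w : sorted ltn (wsupp w).
Proof. by apply: sorted_filter; [exact: ltn_trans | exact: iota_ltn_sorted]. Qed.

Lemma size_wsupp w : size (wsupp w) = size (wparts w).
Proof. by rewrite wpartsE size_map. Qed.

Lemma wparts_gt0 w : all (fun k => 0 < k)%N (wparts w).
Proof. by apply/allP => k; rewrite mem_filter lt0n => /andP[]. Qed.

(** One of many words for [m], which differ by trailing zeros. The trivial monomial gets the
    one-letter word [[:: 0]]. *)
Definition word_of m := mkseq m (\max_(i <- finsupp m) i).+1.

Lemma word_ofK m : monw (word_of m) = m.
Proof.
apply/fsfunP => i; rewrite monwE.
have [lt_i|le_i] := ltnP i (\max_(j <- finsupp m) j).+1; first by rewrite nth_mkseq.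
rewrite nth_default ?size_mkseq //; apply/esym/eqP; rewrite -memNfinsupp.
by apply: contraL le_i => im; rewrite -ltnNge ltnS; exact: leq_bigmax_seq.
Qed.

Lemma monw_surj m : exists w, m = monw w.
Proof. by exists (word_of m); rewrite word_ofK. Qed.

Lemma finsupp_monw w : perm_eq (finsupp (monw w)) (wsupp w).
Proof.
apply: uniq_perm; first exact: fset_uniq; first by rewrite filter_uniq ?iota_uniq.
by move=> i; rewrite mem_finsupp monwE mem_wsupp.
Qed.

Lemma sumn_wparts w : sumn (wparts w) = sumn w.
Proof. by elim: w => //= -[|a] w /= ->. Qed.

Lemma mdeg_monw w : mdeg (monw w) = sumn w.
Proof.
rewrite /mdeg (perm_big _ (finsupp_monw w)) /= -sumn_wparts wpartsE sumnE big_map.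
by apply: eq_bigr => i _; rewrite monwE.
Qed.

Fixpoint splits w : seq (seq nat * seq nat) :=
  if w is a :: w' then
    [seq (i :: p.1, (a - i)%N :: p.2) | i <- iota 0 a.+1, p <- splits w']
  else [:: ([::], [::])].

Lemma splits_cons a w : splits (a :: w) =
  [seq (i :: p.1, (a - i)%N :: p.2) | i <- iota 0 a.+1, p <- splits w].
Proof. by []. Qed.

Lemma mem_splits w p : p \in splits w =
  [&& size p.1 == size w, size p.2 == size w
    & all (fun i => nth 0 w i == nth 0 p.1 i + nth 0 p.2 i)%N (iota 0 (size w))].
Proof.
elim: w p => [|a w IH] [u v].
  by rewrite /= inE andbT; case: u v => [|? ?] [|? ?].
rewrite splits_cons; apply/allpairsP/and3P => [[[i p] []]|[]].
  rewrite mem_iota add0n ltnS => /= le_ia; rewrite IH => /and3P[s1 s2 al] [-> ->] /=.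
  rewrite !eqSS s1 s2 subnKC // eqxx; split=> //=.
  by rewrite (iotaDl 1 0) all_map.
case: u v => [|i u] [|j v] //=; rewrite !eqSS => s1 s2 /andP[/eqP aij al].
have ia : i \in iota 0 a.+1 by rewrite mem_iota add0n ltnS aij leq_addr.
exists (i, (u, v)); split=> //.
  by rewrite IH /= s1 s2; move: al; rewrite (iotaDl 1 0) all_map.
by rewrite aij addKn.
Qed.

Lemma splits_uniq w : uniq (splits w).
Proof.
elim: w => // a w IH; rewrite splits_cons.
apply: allpairs_uniq => //; first exact: iota_uniq.
by move=> [i [u v]] [j [u' v']] _ _ /= [-> -> _ ->].
Qed.

Lemma monw_inj u v : size u = size v -> monw u = monw v -> u = v.
Proof.
move=> suv E; apply: (@eq_from_nth _ 0%N) => // i _.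
by rewrite -!monwE E.
Qed.

Variable F : comPzRingType.

Definition wcoef (f : fps F) : seq nat -> F := fun w => f (monw w).

Lemma wcoef_inj (f g : fps F) : wcoef f = wcoef g -> f = g.
Proof.
move=> fg; apply/funext => m; have [w ->] := monw_surj m.
exact: (congr1 (fun c => c w) fg).
Qed.

(** Deleting a zero letter changes the variables but not the sequence of nonzero exponents. *)
Lemma zinv_wcoef (f : fps F) : quasisymmetric f -> zinv (wcoef f).
Proof.
move=> qf u v; rewrite /wcoef !monw_monom_of.
have -> : wparts (u ++ 0%N :: v) = wparts (u ++ v) by rewrite /wparts !filter_cat.
by apply: qf; rewrite ?wparts_gt0 ?sorted_wsupp ?size_wsupp // /wparts !filter_cat.
Qed.

Lemma wmul_splits (c d : seq nat -> F) w :
  wmul c d w = \sum_(p <- splits w) c p.1 * d p.2.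
Proof.
elim: w c d => [|a w IH] c d; first by rewrite big_seq1.
rewrite splits_cons big_allpairs_dep -[iota _ _]/(index_iota 0 a.+1) big_mkord.
by apply: eq_bigr => i _; exact: IH.
Qed.

(** Factors of [monw w] involve only the first [size w] variables, and words of that length are
    determined by their monomials, so factorizations correspond to [splits w]. *)
Lemma wcoef_mul (f g : fps F) : wcoef (fps_mul f g) = wmul (wcoef f) (wcoef g).
Proof.
apply/funext => w; rewrite wmul_splits /wcoef /fps_mul.
pose h (p : seq nat * seq nat) := (monw p.1, monw p.2).
have uh : uniq (map h (splits w)).
  rewrite map_inj_in_uniq ?splits_uniq // => -[u v] [u' v'].
  rewrite !mem_splits /= => /and3P[/eqP s1 /eqP s2 _] /and3P[/eqP s3 /eqP s4 _].
  case=> /monw_inj u_eq /monw_inj v_eq.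
  by rewrite u_eq ?s1 ?s3 // v_eq ?s2 ?s4.
have -> : factorizations (monw w) = [set` map h (splits w)]%classic.
  apply/seteqP; split=> [[u v] /= uv|_ /mapP[[u v] + ->] i] /=.
    apply/mapP; exists (mkseq u (size w), mkseq v (size w)).
      rewrite mem_splits /= !size_mkseq !eqxx /=; apply/allP => i.
      by rewrite mem_iota add0n /= => iw; rewrite !nth_mkseq // -monwE uv.
    have uv0 i : (size w <= i)%N -> (u i = 0 /\ v i = 0)%N.
      move=> wi; have := uv i; rewrite monwE nth_default // => /esym/eqP.
      by rewrite addn_eq0 => /andP[/eqP-> /eqP->].
    congr pair; apply/fsfunP => i; rewrite monwE.
      have [iw|wi] := ltnP i (size w); first by rewrite nth_mkseq.
      by rewrite nth_default ?size_mkseq //; case: (uv0 i wi).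
    have [iw|wi] := ltnP i (size w); first by rewrite nth_mkseq.
    by rewrite nth_default ?size_mkseq //; case: (uv0 i wi).
  rewrite mem_splits /= !monwE => /and3P[/eqP s1 /eqP s2 /allP al].
  have [iw|wi] := ltnP i (size w); first by apply/eqP/al; rewrite mem_iota.
  by rewrite !nth_default ?s1 ?s2.
by rewrite -fsbig_seq // big_map.
Qed.

End Monomials.

(** * Enumeration of P-partitions *)

Section Enumeration.
Variables (disp : Order.disp_t) (P : finPOrderType disp).
Implicit Types (W I J B : {set P}) (w u v : seq nat) (th : {ffun P -> nat}).

(** Restores the fibre [I] over 0 that [npart] splits off. The value 0 off [W] makes the function
    depend only on its restriction to [W]. *)
Definition shift_part W I th : {ffun P -> nat} :=
  [ffun x => if x \in W :\: I then (th x).+1 else 0%N].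

Fixpoint parts W w : seq {ffun P -> nat} :=
  if w is a :: w' then
    [seq shift_part W J th | J <- enum [pred J | is_ideal W J && (#|J| == a)],
                             th <- parts (W :\: J) w']
  else nseq (W == set0) [ffun=> 0%N].

Lemma size_parts W w : size (parts W w) = npart W w.
Proof.
elim: w W => [|a w IH] W /=; first by rewrite size_nseq.
rewrite size_allpairs_dep sumnE big_map big_enum /=.
by apply: eq_bigr => I _; rewrite IH.
Qed.

Definition partition_on W w th :=
  [/\ forall x, x \notin W -> th x = 0%N,
      {in W &, forall x y, (x <= y)%O -> (th x <= th y)%N}
    & forall i, #|[set x in W | th x == i]| = nth 0%N w i].

Lemma mem_parts W w th : reflect (partition_on W w th) (th \in parts W w).
Proof.
elim: w W th => [|a w IH] W th /=.
  have [->|Wn0] := eqVneq W set0; rewrite /= ?inE; last first.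
    constructor=> -[_ _ cth]; case/set0Pn: Wn0 => x xW.
    have /eqP := cth (th x); rewrite nth_nil cards_eq0 => /eqP/setP/(_ x).
    by rewrite !inE xW eqxx.
  apply: (iffP eqP) => [->|[th0 _ _]]; last first.
    by apply/ffunP => x; rewrite ffunE th0 ?inE.
  split=> [x _|x y|i]; [by rewrite ffunE | by rewrite inE |].
  by rewrite nth_nil; apply/eqP; rewrite cards_eq0; apply/eqP/setP => x; rewrite !inE.
apply: (iffP allpairsPdep) => [[I [th' []]]|[th0 mth cth]].
  rewrite mem_enum inE => /andP[/is_idealP[IW dI] /eqP cI] /IH[th0 mth cth] ->.
  split=> [x xW|x y xW yW xy|i].
  - by rewrite ffunE inE (negPf xW) andbF.
  - rewrite !ffunE !inE xW yW !andbT; case: ifP => // xI.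
    have yI : y \notin I by apply: contra xI => yI; exact: dI xy.
    by rewrite yI ltnS mth // !inE ?xI ?yI.
  - case: i => [|i] /=.
      rewrite -cI; apply: eq_card => x; rewrite !inE ffunE inE.
      case: (boolP (x \in I)) => [/(subsetP IW)->|_] //=.
      by case: (x \in W).
    rewrite -cth; apply: eq_card => x; rewrite !inE ffunE inE.
    by case: (x \in I); case: (x \in W).
pose I := [set x in W | th x == 0%N]; exists I, [ffun x => (th x).-1].
have WI x : (x \in W :\: I) = (x \in W) && (0 < th x)%N.
  by rewrite !inE lt0n; case: (x \in W); rewrite ?andbF ?andbT.
split.
- rewrite mem_enum inE cth eqxx andbT; apply/is_idealP; split.
    by apply/subsetP => x; rewrite inE => /andP[].
  move=> x y; rewrite !inE => /andP[xW /eqP x0] yW yx; rewrite yW /=.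
  by rewrite -leqn0 -x0 mth.
- apply/IH; split=> [x|x y|i].
  + rewrite WI ffunE negb_and => /orP[/th0->//|].
    by rewrite -leqNgt leqn0 => /eqP->.
  + rewrite !WI !ffunE => /andP[xW _] /andP[yW _] xy.
    by rewrite -!subn1 leq_sub2r // mth.
  + rewrite -[RHS]/(nth 0%N (a :: w) i.+1) -cth; apply: eq_card => x.
    rewrite inE WI ffunE [in RHS]inE -andbA; congr (_ && _).
    by case: (th x).
- apply/ffunP => x; rewrite ffunE WI ffunE.
  case: (boolP (x \in W)) => [xW|/th0->//] /=.
  by case: (th x).
Qed.

(** The chosen ideal is recovered as the zero fibre inside [W], after which the shift can be
    undone. *)
Lemma parts_uniq W w : uniq (parts W w).
Proof.
elim: w W => [|a w IH] W /=; first by case: (W == set0).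
apply: (@allpairs_uniq_dep _ (fun=> {ffun P -> nat})) => //; first exact: enum_uniq.
pose snd_tag (p : {_ : {set P} & {ffun P -> nat}}) := projT2 p.
move=> [I th] [J th'] /allpairsPdep[I1 [t1 [I1P t1P E1]]].
move=> /allpairsPdep[I2 [t2 [I2P t2P E2]]] /=.
have -> : I = I1 by exact: (congr1 (@tag _ _) E1).
have -> : th = t1 by exact: (congr1 snd_tag E1).
have -> : J = I2 by exact: (congr1 (@tag _ _) E2).
have -> : th' = t2 by exact: (congr1 snd_tag E2).
move: I1P I2P t1P t2P; rewrite !mem_enum !inE.
move=> /andP[/is_ideal_sub I1W _] /andP[/is_ideal_sub I2W _].
move=> /mem_parts[t10 _ _] /mem_parts[t20 _ _] /ffunP E.
have I12 : I1 = I2.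
  apply/setP => x; have := E x; rewrite !ffunE !inE.
  have [xW|xW] := boolP (x \in W); last first.
    by rewrite (contraNF (subsetP I1W x) xW) (contraNF (subsetP I2W x) xW).
  by case: (x \in I1); case: (x \in I2).
rewrite -I12 in t20 E *; congr (Tagged _ _); apply/ffunP => x.
have [xWI|xWI] := boolP (x \in W :\: I1); last by rewrite t10 ?t20.
by have := E x; rewrite !ffunE xWI => -[].
Qed.

Lemma K_gen_monw (F : pzRingType) w :
  @K_gen F disp P (monw w) = (npart [set: P] w)%:R.
Proof.
rewrite /K_gen -size_parts; congr _%:R.
have -> : @P_partitions_of_content _ P (monw w) =
    [set` [fset th in parts setT w]%fset]%classic.
  apply/seteqP; split=> th /=; rewrite inE /=.
    move=> [mth cth]; apply/mem_parts; split=> [x|x y _ _|i].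
    - by rewrite inE.
    - exact: mth.
    - by rewrite -monwE -cth; apply: eq_card => x; rewrite !inE.
  move=> /mem_parts[_ mth cth]; split=> [x y|i]; first by apply: mth; rewrite inE.
  by rewrite monwE -cth; apply: eq_card => x; rewrite !inE.
by rewrite set_fsetK card_fseq undup_id // parts_uniq.
Qed.
End Enumeration.

(** * Multiplicativity over disjoint unions *)

Section DisjointUnion.
Variables (disp : Order.disp_t) (P : finPOrderType disp).
Implicit Types (A B I J : {set P}) (w : seq nat).

Definition unrelated A B :=
  forall x y, x \in A -> y \in B -> ~~ (x <= y)%O && ~~ (y <= x)%O.

Lemma is_idealU A B I J : unrelated A B ->
  I \subset A -> J \subset B ->
  is_ideal (A :|: B) (I :|: J) = is_ideal A I && is_ideal B J.
Proof.
move=> AB IA JB; apply/is_idealP/andP => [[_ d]|[/is_idealP[_ dI] /is_idealP[_ dJ]]].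
  split; apply/is_idealP; split=> // x y xI yA yx.
    have := d x y; rewrite !inE xI yA => /(_ isT isT yx) /orP[//|/(subsetP JB) yB].
    by have := AB y y yA yB; rewrite lexx.
  have := d x y; rewrite !inE xI yA !orbT => /(_ isT isT yx) /orP[/(subsetP IA) yA'|//].
  by have := AB y y yA' yA; rewrite lexx.
split=> [|x y]; first exact: setUSS.
rewrite !inE => /orP[xI|xJ] /orP[yA|yB] yx; apply/orP.
- by left; exact: dI yx.
- by have := AB x y (subsetP IA _ xI) yB; rewrite yx andbF.
- by have := AB y x yA (subsetP JB _ xJ); rewrite yx.
- by right; exact: dJ yx.
Qed.

Lemma wmul_sum (F : comPzRingType) (T1 T2 : finType) (Q1 : pred T1) (Q2 : pred T2)
    (c : T1 -> seq nat -> F) (d : T2 -> seq nat -> F) w :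
  wmul (\sum_(i | Q1 i) c i) (\sum_(j | Q2 j) d j) w =
  \sum_(i | Q1 i) \sum_(j | Q2 j) wmul (c i) (d j) w.
Proof.
rewrite -[LHS]/(wmul_in _ w (\sum_(i | Q1 i) c i)) raddf_sum.
apply: eq_bigr => i _; apply: etrans (wmulC _ _ _) _.
rewrite -[LHS]/(wmul_in _ w (\sum_(j | Q2 j) d j)) raddf_sum.
by apply: eq_bigr => j _; exact: wmulC.
Qed.

(** An ideal of the union is a pair of ideals, one in each part; sharing its size between them is
    the splitting of the first letter in [wmul]. *)
Lemma kpart_setU (F : numDomainType) A B :
  unrelated A B ->
  kpart F (A :|: B) = wmul (kpart F A) (kpart F B).
Proof.
move=> AB; apply/funext => w; elim: w A B AB => [|a w IH] A B AB.
  by rewrite /kpart /= setU_eq0 -natrM mulnb.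
have wconsE i A' : wcons i (kpart F A') =
    \sum_(I | is_ideal A' I && (#|I| == i)) kpart F (A' :\: I).
  by apply/funext => t; rewrite fct_sumE /wcons /kpart /= natr_sum.
have AB0 : A :&: B = set0.
  apply/eqP/set0Pn => -[x]; rewrite inE => /andP[xA xB].
  by have := AB x x xA xB; rewrite lexx.
pose G (p : {set P} * {set P}) := kpart F ((A :\: p.1) :|: (B :\: p.2)) w.
transitivity (\sum_(p | is_ideal A p.1 && is_ideal B p.2 && (#|p.1| + #|p.2| == a)%N)
   G p); last first.
  rewrite /= (partition_big (fun p : {set P} * {set P} => inord #|p.1| : 'I_a.+1)
    xpredT) //=; apply: eq_bigr => i _.
  rewrite !wconsE wmul_sum pair_big /=; apply: eq_big => [[I J]|[I J] _] /=.
    rewrite -val_eqE /=; apply/idP/idP.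
      move=> /andP[/andP[/andP[-> ->] /eqP aE]]; rewrite inordK ?ltnS -?aE ?leq_addr //.
      by move=> /eqP <-; rewrite -[X in (X - _)%N]aE addKn !eqxx.
    move=> /andP[/andP[-> /eqP cI] /andP[-> /eqP cJ]].
    by rewrite cI cJ subnKC ?leq_ord // eqxx inordK //=.
  rewrite /G IH // => x y; rewrite !inE => /andP[_ xA] /andP[_ yB]; exact: AB.
have wc : kpart F (A :|: B) (a :: w) = wcons a (kpart F (A :|: B)) w by [].
rewrite wc wconsE fct_sumE.
have KE (K : {set P}) : K \subset A :|: B -> K = (K :&: A) :|: (K :&: B).
  by move=> KAB; rewrite -setIUr; apply/esym/setIidPl.
have UI I J : I \subset A -> J \subset B -> (I :|: J) :&: A = I /\ (I :|: J) :&: B = J.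
  move=> IA JB; rewrite !setIUl (setIidPl IA) (setIidPl JB); split.
    rewrite (_ : J :&: A = set0) ?setU0 //; apply/eqP.
    by rewrite -subset0 -AB0 setIC setIS.
  rewrite (_ : I :&: B = set0) ?set0U //; apply/eqP.
  by rewrite -subset0 -AB0 setSI.
rewrite (reindex_onto (fun p => p.1 :|: p.2) (fun K => (K :&: A, K :&: B))) /=; last first.
  by move=> K /andP[/is_ideal_sub /KE].
apply: eq_big => [[I J]|[I J] /andP[_ /eqP[<- <-]]] /=.
  have [/andP[IA JB]|] := boolP ((I \subset A) && (J \subset B)).
    have [-> ->] := UI I J IA JB; rewrite eqxx andbT is_idealU //.
    rewrite cardsU (_ : I :&: J = set0) ?cards0 ?subn0 //; apply/eqP.
    by rewrite -subset0 -AB0 setISS.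
  move=> nIJ; transitivity false.
    apply: contraNF nIJ => /andP[_ /eqP[<- <-]].
    by rewrite !subsetIr.
  apply/esym; apply: contraNF nIJ => /andP[/andP[/is_ideal_sub-> /is_ideal_sub->]].
  by [].
rewrite /G /=; congr (kpart F _ w); apply/setP => x; rewrite !inE.
case: (boolP (x \in A)) => [xA|xA]; case: (boolP (x \in B)) => [xB|xB];
  rewrite ?andbT ?andbF ?orbF //=.
by have := in_set0 x; rewrite -AB0 inE xA xB.
Qed.
End DisjointUnion.

(** * Irreducibility *)

Section SeriesOfWordFunction.
Variable F : comPzRingType.
Implicit Types (c : seq nat -> F) (w u v : seq nat).

Lemma zinv_wparts c w : zinv c -> c w = c (wparts w).
Proof.
move=> zc; rewrite -[w]cat0s -[wparts w]cat0s.
elim: w [::] => // a w IH u /=; case: eqVneq => [->|_] /=; first by rewrite zc.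
by rewrite -!cat_rcons.
Qed.

Lemma zinv_monw c u v : zinv c -> monw u = monw v -> c u = c v.
Proof.
move=> zc uv; rewrite -(zinv_pad u (size v) zc) -(zinv_pad v (size u) zc).
congr c; apply: monw_inj; first by rewrite !size_cat !size_nseq addnC.
have padE s n : monw (s ++ nseq n 0%N) = monw s.
  apply/fsfunP => i; rewrite !monwE nth_cat; case: ltnP => // le_si.
  by rewrite nth_nseq nth_default // if_same.
by rewrite !padE.
Qed.

Definition fps_of c : fps F := fun m => c (word_of m).

Lemma wcoef_fps_of c : zinv c -> wcoef (fps_of c) = c.
Proof.
move=> zc; apply/funext => w; rewrite /wcoef /fps_of; apply: zinv_monw => //.
exact: word_ofK.
Qed.

Lemma wparts_monom_of s a w : all (fun k => 0 < k)%N a -> sorted ltn s ->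
  size s = size a -> monom_of s a = monw w -> wparts w = a.
Proof.
move=> a_gt0 s_sorted sa E.
have nthE i : nth 0%N w i = if i \in s then nth 0%N a (index i s) else 0%N.
  by rewrite -monwE -E fsfunE inE.
have sE : wsupp w = s.
  apply: (irr_sorted_eq ltn_trans ltnn) => // [|i]; first exact: sorted_wsupp.
  rewrite mem_wsupp nthE; case: ifP => // si; rewrite -lt0n.
  by apply: (allP a_gt0); rewrite mem_nth // -sa index_mem.
rewrite wpartsE sE; apply: (@eq_from_nth _ 0%N); rewrite size_map // => i lt_i.
rewrite (nth_map 0%N) // nthE mem_nth // index_uniq //.
exact: (sorted_uniq ltn_trans ltnn).
Qed.

(** Removing zeros from any word for [monom_of r a] gives [a], so the coefficient is [c a] whatever
    [r] is. *)
Lemma quasisymmetric_fps_of c : zinv c -> quasisymmetric (fps_of c).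
Proof.
move=> zc a s t a_gt0 ss st sa ta.
suff fE r : sorted ltn r -> size r = size a -> fps_of c (monom_of r a) = c a.
  by rewrite !fE.
move=> rs ra; have [w E] := monw_surj (monom_of r a).
rewrite E -/(wcoef _ w) wcoef_fps_of // (zinv_wparts w zc).
by rewrite (wparts_monom_of a_gt0 rs ra E).
Qed.
End SeriesOfWordFunction.

(** * Connectedness against factorization *)

Section Main.
Variables (F : numDomainType) (disp : Order.disp_t) (P : finPOrderType disp).

Lemma le_connect (x y : P) : (x <= y)%O ->
  connect (fun u v => covers u v || covers v u) x y.
Proof.
have [n] := ubnP #|[set z | x <= z <= y]%O|; elim: n x y => // n IH x y lt_n le_xy.
have [->|ne_xy] := eqVneq x y; first exact: connect0.
have lt_xy : (x < y)%O by rewrite lt_neqAle ne_xy.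
have [/existsP[z /andP[xz zy]]|ncov] := boolP [exists z, (x < z)%O && (z < y)%O].
  apply: (connect_trans (IH x z _ (ltW xz))); last apply: IH (ltW zy).
    rewrite -ltnS (leq_trans _ lt_n) // ltnS proper_card //; apply/properP; split.
      by apply/subsetP => t; rewrite !inE => /andP[-> tz]; exact: le_trans (ltW zy).
    by exists y; rewrite !inE ?le_xy ?lexx // (lt_geF zy) andbF.
  rewrite -ltnS (leq_trans _ lt_n) // ltnS proper_card //; apply/properP; split.
    by apply/subsetP => t; rewrite !inE => /andP[zt ->]; rewrite (le_trans (ltW xz)).
  by exists x; rewrite !inE ?le_xy ?lexx // (lt_geF xz).
by apply: connect1; rewrite /covers lt_xy ncov.
Qed.

Lemma wcoef_K_gen : wcoef (K_gen F P) = kpart F [set: P].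
Proof. by apply/funext => w; rewrite /wcoef K_gen_monw. Qed.

Lemma QSym_fps_of_kpart (A : {set P}) : QSym (fps_of (kpart F A)).
Proof.
split; last exact: quasisymmetric_fps_of (zinv_kpart F A).
exists #|A| => m; have [w ->] := monw_surj m.
rewrite -/(wcoef _ w) (wcoef_fps_of (zinv_kpart F A)) mdeg_monw pnatr_eq0 -lt0n.
by move=> /npart_sumn->.
Qed.

Lemma fps_of_kpart_nonconstant (A : {set P}) : A != set0 ->
  ~ fps_constant (fps_of (kpart F A)).
Proof.
move=> A0 /(_ (monw [:: #|A|])) H.
have/H : monw [:: #|A|] != [fsfun].
  apply: contra_neq A0 => /fsfunP/(_ 0%N); rewrite monwE fsfunE /= => /eqP.
  by rewrite cards_eq0 => /eqP.
rewrite -/(wcoef _ _) (wcoef_fps_of (zinv_kpart F A)) => /eqP; apply/negP.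
(* The constant map, with [A] as its only fibre, is counted here. *)
rewrite pnatr_eq0 -lt0n /= lt0n sum_nat_eq0; apply/forall_inPn; exists A.
  by rewrite unfold_in eqxx andbT; apply/is_idealP; split=> // x y _ ->.
by rewrite setDv eqxx.
Qed.

Lemma wbounded_wcoef (f : fps F) : bounded_degree f -> wbounded (wcoef f).
Proof. by move=> [b fb]; exists b => w /fb; rewrite mdeg_monw. Qed.

Lemma nonconstant_wcoef (f : fps F) : ~ fps_constant f ->
  exists2 w, (0 < sumn w)%N & wcoef f w != 0.
Proof.
move=> /existsNP[m /not_implyP[m0 /eqP fm]]; have [w mE] := monw_surj m.
exists w; last by rewrite /wcoef -mE.
rewrite lt0n; apply: contraNneq m0 => w0; rewrite mE; apply/eqP/fsfunP => i.
rewrite monwE fsfunE; apply/eqP; move: w0 => /eqP.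
rewrite sumnE sum_nat_seq_eq0 => /allP w0.
have [iw|wi] := ltnP i (size w); last by rewrite nth_default.
by apply: (w0 (nth 0%N w i)); exact: mem_nth.
Qed.

Lemma connected_iff_irreducible : (0 < #|P|)%N ->
  poset_connected P <-> QSym_irreducible (K_gen F P).
Proof.
move=> P0; split=> [conP [f [g [[bf qf] [bg qg] ncf ncg KE]]]|irr].
  have [lam kl] := exists_functional F P0 conP.
  have zf := zinv_wcoef qf; have zg := zinv_wcoef qg.
  have E : wmul (wcoef f) (wcoef g) = kpart F [set: P].
    by rewrite -wcoef_mul -KE wcoef_K_gen.
  have hom w : kpart F [set: P] w != 0 -> sumn w = #|P|.
    by rewrite pnatr_eq0 -lt0n => /npart_sumn->; rewrite cardsT.
  have [wf wf0 fw] := nonconstant_wcoef ncf.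
  have [wg wg0 gw] := nonconstant_wcoef ncg.
  (* Both constant terms must vanish; [wmul_homogeneous_nil] treats the right factor, hence its use
     once with the factors exchanged. *)
  case/negP; apply/eqP; rewrite -E; apply: kl => //.
    apply: (@wmul_homogeneous_nil _ #|P| (wcoef g)) => //; try exact: wbounded_wcoef.
    - by move=> w; rewrite wmulC E; exact: hom.
    - by exists wg.
    - by exists wf.
  apply: (@wmul_homogeneous_nil _ #|P| (wcoef f)) => //; try exact: wbounded_wcoef.
  - by move=> w; rewrite E; exact: hom.
  - by exists wf.
  - by exists wg.
apply: contrapT => /existsNP[x /existsNP[y /negP nxy]]; apply: irr.
set e := (fun u v : P => covers u v || covers v u) in nxy.
have e_sym : connect_sym e by apply: sym_connect_sym => p q; rewrite /e orbC.
(* The component of [x] misses [y]; comparable elements share a component, so [A] and its complement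
   are unrelated. *)
pose A := [set z | connect e x z].
have AE : A :|: ~: A = setT by exact: setUCr.
exists (fps_of (kpart F A)), (fps_of (kpart F (~: A))); split.
- exact: QSym_fps_of_kpart.
- exact: QSym_fps_of_kpart.
- by apply: fps_of_kpart_nonconstant; apply/set0Pn; exists x; rewrite inE connect0.
- by apply: fps_of_kpart_nonconstant; apply/set0Pn; exists y; rewrite !inE.
apply: wcoef_inj; rewrite wcoef_mul !(wcoef_fps_of (zinv_kpart F _)) wcoef_K_gen.
rewrite -AE kpart_setU // => p q; rewrite !inE => xp nxq.
apply/andP; split; apply: contra nxq => /le_connect pq; apply: connect_trans xp _ => //.
by rewrite e_sym.
Qed.

End Main.

Theorem theorem4p19 (R : realType) (d : Order.disp_t) (P : finPOrderType d)
  (P_nonempty : (0 < #|P|)%N) :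
  poset_connected P <-> QSym_irreducible (K_gen (complex R) P).
Proof. exact: connected_iff_irreducible. Qed.
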